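(* Let $d>0$ be an integer, let $\delta>0$ be given, and let $$K=\{(x_1,\dots,x_n)\in\mathbb{R}^n: 0\le x_i\le\delta,\ i=1,\dots,n\}.$$ Then for each $k\in\{0,\dots,n\}$ the set $\mathcal{D}_k\subset\mathbb{R}^{n\times\rho_{n,d}}$ is nonempty and contains a semialgebraic subset $\mathcal{E}_k\subset\mathbb{R}^{n\times\rho_{n,d}}$ such that $$\dim(\mathcal{E}_k)=(n-k)\times\rho_{n-k,d}.$$
   Context: For integers $r\ge 0$ and $d>0$, $\rho_{r,d}=\binom{r+d}{d}$; $\rho_{n,d}$ is the dimension of the space of real polynomials in $n$ variables of degree at most $d$. Let $X=(1,x_1,\dots,x_n,x_1^2,x_1x_2,\dots,x_n^d)^T$ be the vector of all $\rho_{n,d}$ monomials in $x_1,\dots,x_n$ of degree at most $d$, in a fixed order; each matrix $A\in\mathbb{R}^{n\times\rho_{n,d}}$ corresponds to the polynomial map $\mathbb{R}^n\to\mathbb{R}^n$, $x\mapsto AX$. For a polynomial map $F:\mathbb{R}^n\to\mathbb{R}^n$, $\operatorname{Sol}(K,F)=\{x\in K:\langle F(x),y-x\rangle\ge 0\ \text{for all } y\in K\}$, which is a semialgebraic set. For $k\in\{-\infty,0,1,\dots,n\}$, $\mathcal{D}_k$ is the set of all matrices $A\in\mathbb{R}^{n\times\rho_{n,d}}$ such that $\dim(\operatorname{Sol}(K,AX))=k$. Dimension: every semialgebraic set $S$ is a finite disjoint union of semialgebraic subsets $S_i$ semialgebraically diffeomorphic to $(0,1)^{d_i}$ (with $(0,1)^0$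 a point), and $\dim S=\max_i d_i$; convention $\dim(\emptyset)=-\infty$. *)

(* Defs.v *)
From HB Require Import structures.
From mathcomp Require Import all_boot all_order all_algebra.
From mathcomp Require Import all_classical all_reals all_analysis.
(* The notations of mpoly clash with those of mathcomp-analysis. *)
From mathcomp Require Import -(notations) mpoly.

Set Implicit Arguments.
Unset Strict Implicit.
Unset Printing Implicit Defensive.

Import Order.TTheory GRing.Theory Num.Theory.
Import numFieldNormedType.Exports.

Local Open Scope classical_set_scope.
Local Open Scope ring_scope.

Definition rho (r d : nat) : nat := 'C(r + d, d)%N.

(* Multi-indices in n variables of total degree at most d, i.e. < d.+1. *)
Notation mono n d := (bmultinom n d.+1).

(* An ordering of the monomials is a bijection 'I_(rho n d) -> mono n d; one
   exists by this count. *)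
Lemma card_mono (n d : nat) : #|{: mono n d}| = rho n d.
Proof.
rewrite /rho -bin_sub ?leq_addl// addnK -card_partial_ord_partitions.
have le_mdeg (m : mono n d) (i : 'I_n) :
    (m i < d.+1)%N.
  case: m => m /=; rewrite mdegE ltnS => mP; rewrite ltnS.
  by apply: leq_trans mP; rewrite (bigD1 i)//= leq_addr.
pose f (m : mono n d) : n.-tuple 'I_d.+1 := [tuple Ordinal (le_mdeg m i) | i < n].
have f_inj : injective f.
  move=> m1 m2 eq_f; apply/val_inj/mnmP => i.
  by have /(congr1 val) := congr1 (fun t => tnth t i) eq_f; rewrite !tnth_mktuple.
rewrite -(card_imset _ f_inj) /=; apply: eq_card => t.
rewrite [RHS]inE.
apply/imsetP/idP => [[m _ ->]|tP].
  rewrite big_tuple; under eq_bigr do rewrite tnth_mktuple /=.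
  by rewrite -mdegE -ltnS; case: m.
pose m0 := Multinom [tuple val (tnth t i) | i < n].
have m0P : (mdeg m0 < d.+1)%N.
  rewrite mdegE ltnS; move: tP; rewrite big_tuple.
  by under [X in (_ <= _)%N -> (X <= _)%N]eq_bigr do
    rewrite multinomE tnth_mktuple.
exists (BMultinom m0P) => //; apply/eq_from_tnth => i.
by apply/val_inj; rewrite tnth_mktuple /= multinomE tnth_mktuple.
Qed.

Section Semialgebraic.
Variable R : realType.

(* Points of R^N are row vectors 'rV[R]_N. *)

Definition peval (N : nat) (p : mpoly N R) (x : 'rV[R]_N) : R :=
  meval (fun i => x 0 i) p.

(* Finite union of sets { p = 0 for p in c.1, q > 0 for q in c.2 }. *)
Definition semialgebraic (N : nat) (S : set 'rV[R]_N) : Prop :=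
  exists L : seq (seq (mpoly N R) * seq (mpoly N R)),
    S = [set x | has (fun c => all (fun p => peval p x == 0) c.1
                            && all (fun q => 0 < peval q x) c.2) L].

Definition graph_on (p q : nat) (A : set 'rV[R]_p) (f : 'rV[R]_p -> 'rV[R]_q) :
    set 'rV[R]_(p + q) :=
  [set row_mx x (f x) | x in A].

(* Class C^k on an open set U; 'D_v f is the derivative of f in direction v. *)
Fixpoint Ck (p q : nat) (k : nat) (U : set 'rV[R]_p) (f : 'rV[R]_p -> 'rV[R]_q) :
    Prop :=
  match k with
  | 0%N => forall x, U x -> {for x, continuous f}
  | k'.+1 => (forall x, U x -> differentiable f x) /\
             (forall v : 'rV[R]_p, Ck k' U (fun x => 'D_v f x))
  end.

(* C^infty map on an arbitrary subset A: locally the restriction of a C^infty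
   map defined on an open set of the ambient space. *)
Definition smooth_on (p q : nat) (A : set 'rV[R]_p) (f : 'rV[R]_p -> 'rV[R]_q) :
    Prop :=
  forall x, A x -> exists (U : set 'rV[R]_p) (h : 'rV[R]_p -> 'rV[R]_q),
    [/\ open U, U x, forall k, Ck k U h & forall y, A y -> U y -> h y = f y].

(* The graph of the inverse is the graph of f up to a permutation of the
   coordinates, so that g is semialgebraic on B as well. *)
Definition semialg_diffeomorphic (p q : nat)
    (A : set 'rV[R]_p) (B : set 'rV[R]_q) : Prop :=
  exists (f : 'rV[R]_p -> 'rV[R]_q) (g : 'rV[R]_q -> 'rV[R]_p),
    [/\ forall x, A x -> B (f x) /\ g (f x) = x,
        forall y, B y -> A (g y) /\ f (g y) = y,
        smooth_on A f, smooth_on B g & semialgebraic (graph_on A f)].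

Definition open_cube (m : nat) : set 'rV[R]_m :=
  [set x | forall i, 0 < x 0 i < 1].

(* S has dimension k : \bar R, where k is a natural number or -oo.  The value
   does not depend on the decomposition; the maximum over the empty
   decomposition, which is the only one of set0, is -oo. *)
Definition has_dim (N : nat) (S : set 'rV[R]_N) (k : \bar R) : Prop :=
  exists (m : nat) (dims : 'I_m -> nat) (C : 'I_m -> set 'rV[R]_N),
    [/\ S = \bigcup_(i in [set: 'I_m]) C i,
        trivIset [set: 'I_m] C,
        forall i, semialgebraic (C i),
        forall i, semialg_diffeomorphic (C i) (@open_cube (dims i)) &
        k = \big[maxe/-oo%E]_(i < m) ((dims i)%:R)%:E].

(* Sets of matrices, seen in R^(p * q). *)
Definition mx_semialgebraic (p q : nat) (E : set 'M[R]_(p, q)) : Prop :=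
  semialgebraic (mxvec @` E).

Definition mx_has_dim (p q : nat) (E : set 'M[R]_(p, q)) (k : \bar R) : Prop :=
  has_dim (mxvec @` E) k.

End Semialgebraic.

Section VariationalInequality.
Variable R : realType.

Definition inner (n : nat) (u v : 'rV[R]_n) : R := \sum_(i < n) u 0 i * v 0 i.

Definition Sol (n : nat) (K : set 'rV[R]_n) (F : 'rV[R]_n -> 'rV[R]_n) :
    set 'rV[R]_n :=
  [set x | K x /\ forall y, K y -> 0 <= inner (F x) (y - x)].

(* The vector X of monomials, listed in the order given by mon. *)
Definition monvec (n d : nat) (mon : 'I_(rho n d) -> mono n d) (x : 'rV[R]_n) :
    'cV[R]_(rho n d) :=
  \col_j \prod_(i < n) x 0 i ^+ mon j i.

Definition polymap (n d : nat) (mon : 'I_(rho n d) -> mono n d)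
    (A : 'M[R]_(n, rho n d)) (x : 'rV[R]_n) : 'rV[R]_n :=
  (A *m monvec mon x)^T.

Definition Dset (n d : nat) (mon : 'I_(rho n d) -> mono n d)
    (K : set 'rV[R]_n) (k : \bar R) : set 'M[R]_(n, rho n d) :=
  [set A | has_dim (Sol K (polymap mon A)) k].

Definition box (n : nat) (delta : R) : set 'rV[R]_n :=
  [set x | forall i, 0 <= x 0 i <= delta].

End VariationalInequality.

(* Main.v *)
Require Import Defs.
From mathcomp Require Import all_boot all_order all_algebra.
From mathcomp Require Import all_classical all_reals all_analysis.
From mathcomp Require Import -(notations) mpoly.
Import Order.TTheory GRing.Theory Num.Theory.
Import numFieldNormedType.Exports.
Local Open Scope classical_set_scope.
Local Open Scope ring_scope.

(** Put r = n - k.  The maps to look at are F(x) = (G(x_1, ..., x_r), 0, ..., 0)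
    where every coefficient of G : R^r -> R^r lies in (0, 1).  Since the box is
    in the nonnegative orthant and the constant coefficient of each G_i is
    positive, G_i > 0 on the whole box; hence x solves the variational
    inequality iff x_1 = ... = x_r = 0: moving a positive coordinate x_i to 0
    would make the inner product negative, and the last k coordinates of F do
    not contribute to it ([Sol_box_slab]).  So the solution set is always
    {0}^r x [0, delta]^k, of dimension k.

    The matrices of these maps have r * rho r d entries that range over (0, 1)
    independently, one for each of the first r rows and each monomial in the
    first r variables ([card_free_entries]), and zeros elsewhere.  They form the
    set E of the theorem.

    Both dimension claims reduce to one kind of set, the coordinate cells
    [coord_cell]: some coordinates range over (0, s), the others are constant.
    Selecting the free coordinates and rescaling them is an affine
    diffeomorphism onto an open cube ([coord_cell_diffeo]).  The set E is one
    cell; {0}^r x [0, delta]^k is the disjoint union of its 3^k open faces,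
    which are cells, the largest being of dimension k ([has_dim_slab]). *)

Set Implicit Arguments.
Unset Strict Implicit.
Unset Printing Implicit Defensive.

(** * Systems of polynomial conditions and affine maps *)

Lemma semialgebraic_system (R : realType) (N : nat) (I J : finType)
    (p : I -> mpoly N R) (q : J -> mpoly N R) :
  semialgebraic [set x | (forall i, peval (p i) x = 0) /\
                         (forall j, 0 < peval (q j) x)].
Proof.
exists [:: ([seq p i | i <- enum I], [seq q j | j <- enum J])].
apply/seteqP; split => x /=; rewrite orbF !all_map.
  move=> [p0 q0]; apply/andP; split; apply/allP => i _ /=; last exact: q0.
  by rewrite p0.
case/andP => /allP p0 /allP q0; split=> i.
  by apply/eqP/p0; rewrite -enumT mem_enum.
by apply: q0; rewrite -enumT mem_enum.
Qed.

Lemma Ck_cst (R : realType) (p q : nat) (c : 'rV[R]_q) (k : nat) :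
  Ck k [set: 'rV[R]_p] (cst c).
Proof.
elim: k c => [|k IH] c /=; first by move=> x _; exact: cst_continuous.
split=> [x _|v]; first exact: differentiable_cst.
rewrite (_ : (fun x => _) = cst 0); first exact: IH.
by apply/funext => x; rewrite derive_cst.
Qed.

(** A linear map is a sum of coordinate functions times fixed vectors. *)
Lemma differentiable_mulmxr (R : realType) (p q : nat) (M : 'M[R]_(p, q))
    (x : 'rV[R]_p) : differentiable (mulmxr M : 'rV[R]_p -> 'rV[R]_q) x.
Proof.
rewrite (_ : (mulmxr M : 'rV[R]_p -> 'rV[R]_q) =
    \sum_(i < p) (fun z : 'rV[R]_p => z 0 i *: row i M)).
  apply: differentiable_sum => i.
  apply: (@differentiableZl _ _ _ (fun z : 'rV[R]_p => z 0 i)).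
  exact: differentiable_coord.
by apply/funext => z; rewrite /= mulmx_sum_row fct_sumE.
Qed.

(** The directional derivatives of an affine map are constant. *)
Lemma Ck_affine (R : realType) (p q : nat) (M : 'M[R]_(p, q)) (c : 'rV[R]_q)
    (k : nat) :
  Ck k [set: 'rV[R]_p] (fun x => x *m M + c).
Proof.
have dM := differentiable_mulmxr M.
have df x : differentiable ((mulmxr M : 'rV[R]_p -> 'rV[R]_q) + cst c) x.
  by apply: differentiableD => //; exact: differentiable_cst.
case: k => [|k] /=.
  by move=> x _; apply: differentiable_continuous; exact: df.
split=> [x _|v]; first exact: df.
rewrite (_ : (fun x => _) = cst (v *m M)); first exact: Ck_cst.
apply/funext => x.
rewrite (@deriveD _ _ _ (mulmxr M : 'rV[R]_p -> 'rV[R]_q) (cst c)).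
- rewrite derive_cst addr0 deriveE// diff_lin//.
  by move=> y; exact: differentiable_continuous.
- exact: diff_derivable.
- exact/diff_derivable/differentiable_cst.
Qed.

Lemma smooth_on_affine (R : realType) (p q : nat) (A : set 'rV[R]_p)
    (M : 'M[R]_(p, q)) (c : 'rV[R]_q) : smooth_on A (fun x => x *m M + c).
Proof.
move=> x _; exists setT, (fun x => x *m M + c); split=> //.
  exact: openT.
by move=> k; exact: Ck_affine.
Qed.

(** * Coordinate cells *)

(** When c is a vertex of [0, s]^N, these are the open faces of that cube that
    contain c in their closure. *)
Definition coord_cell (R : realType) (N : nat) (T : {set 'I_N}) (s : R)
    (c : 'rV[R]_N) : set 'rV[R]_N :=
  [set x | forall i, if i \in T then is_true (0 < x 0 i < s) else x 0 i = c 0 i].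

(** Turns the two inequalities on a free coordinate into a single polynomial
    one, so that every coordinate gives exactly one equation and one
    inequality. *)
Lemma mulr_subr_gt0 (R : realType) (s x : R) : 0 < s ->
  (0 < x * (s - x)) = (0 < x < s).
Proof.
move=> s0; apply/idP/andP => [|[x0 xs]]; last by rewrite mulr_gt0// subr_gt0.
case: (ltrP 0 x) => [x0|x0]; first by rewrite pmulr_rgt0// subr_gt0.
by rewrite ltNge mulr_le0_ge0// subr_ge0 (le_trans x0)// ltW.
Qed.

Section Cell.
Variables (R : realType) (N : nat) (T : {set 'I_N}) (s : R) (c : 'rV[R]_N).
Hypothesis s0 : 0 < s.

Let var (n : nat) (i : 'I_n) : mpoly n R := mpolyX R (mnm1 i).

Let peval_var n (i : 'I_n) x : peval (var i) x = x 0 i.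
Proof. by rewrite /peval mevalXU. Qed.

(* The conditions that define the cell are stated for polynomials v i standing
   for the coordinates: the cell itself lives in R^N, but its graph lives in
   a larger space where the same conditions bear on the first N variables. *)
Let cell_eq n (v : 'I_N -> mpoly n R) (i : 'I_N) : mpoly n R :=
  if i \in T then 0 else v i - mpolyC n (c 0 i).

Let cell_ineq n (v : 'I_N -> mpoly n R) (i : 'I_N) : mpoly n R :=
  if i \in T then v i * (mpolyC n s - v i) else 1.

Let cell_systemP n (v : 'I_N -> mpoly n R) (z : 'rV[R]_n) (x : 'rV[R]_N) :
  (forall i, peval (v i) z = x 0 i) ->
  coord_cell T s c x <-> (forall i, peval (cell_eq v i) z = 0) /\
                         (forall i, 0 < peval (cell_ineq v i) z).
Proof.
move=> vx; rewrite /coord_cell /cell_eq /cell_ineq.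
split=> [xT|[eqs ineqs] i /=].
  split=> i; move: (xT i); rewrite /peval; case: ifP => iT xi.
  - by rewrite meval0.
  - by rewrite mevalB mevalC -/(peval _ _) vx xi subrr.
  - by rewrite mevalM mevalB mevalC -/(peval _ _) vx mulr_subr_gt0.
  - by rewrite meval1.
move: (eqs i) (ineqs i); rewrite /peval; case: ifP => iT.
  by move=> _; rewrite mevalM mevalB mevalC -/(peval _ _) vx mulr_subr_gt0.
by rewrite mevalB mevalC -/(peval _ _) vx => /eqP + _; rewrite subr_eq0 => /eqP.
Qed.

Lemma semialgebraic_coord_cell : semialgebraic (coord_cell T s c).
Proof.
have := semialgebraic_system (cell_eq (@var N)) (cell_ineq (@var N)).
rewrite [X in semialgebraic X -> _](_ : _ = coord_cell T s c)//.
apply/seteqP; split=> x /=.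
  by move/(cell_systemP (fun i => peval_var i x)).
by move/(cell_systemP (fun i => peval_var i x)).
Qed.

(* y *m sel puts y on the free coordinates and 0 elsewhere; x *m sel^T extracts
   the free coordinates of x. *)
Let sel : 'M[R]_(#|T|, N) := \matrix_(j, i) (enum_val j == i)%:R.

Let sel_trE (x : 'rV[R]_N) (j : 'I_#|T|) : (x *m sel^T) 0 j = x 0 (enum_val j).
Proof.
rewrite mxE (bigD1 (enum_val j))//= big1 ?addr0; first by rewrite !mxE eqxx mulr1.
by move=> i /negPf ij; rewrite !mxE eq_sym ij mulr0.
Qed.

Let selE (y : 'rV[R]_#|T|) (j : 'I_#|T|) : (y *m sel) 0 (enum_val j) = y 0 j.
Proof.
rewrite mxE (bigD1 j)//= big1 ?addr0; first by rewrite !mxE eqxx mulr1.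
by move=> i ij; rewrite !mxE (inj_eq enum_val_inj) (negPf ij) mulr0.
Qed.

Let sel_out (y : 'rV[R]_#|T|) (i : 'I_N) : i \notin T -> (y *m sel) 0 i = 0.
Proof.
move=> iT; rewrite mxE big1// => j _; rewrite !mxE.
by case: eqP => [ji|_]; [rewrite -ji enum_valP in iT | rewrite mulr0].
Qed.

(** Both directions are affine: keep the free coordinates and divide them by s;
    conversely multiply by s and restore the constants of c. *)
Lemma coord_cell_diffeo :
  semialg_diffeomorphic (coord_cell T s c) (@open_cube R #|T|).
Proof.
pose f (x : 'rV[R]_N) : 'rV[R]_#|T| := x *m (s^-1 *: sel^T) + 0.
pose g (y : 'rV[R]_#|T|) : 'rV[R]_N :=
  y *m (s *: sel) + \row_i (if i \in T then 0 else c 0 i).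
have fE x j : f x 0 j = s^-1 * x 0 (enum_val j).
  by rewrite /f addr0 -scalemxAr mxE sel_trE.
have gE y j : g y 0 (enum_val j) = s * y 0 j.
  by rewrite /g -scalemxAr !mxE enum_valP addr0 -[X in s * X]selE mxE.
have g_out y i : i \notin T -> g y 0 i = c 0 i.
  by move=> iT; rewrite /g -scalemxAr 2!mxE sel_out// mulr0 add0r mxE (negPf iT).
exists f, g; split.
- move=> x xT; split=> [j|].
    have := xT (enum_val j); rewrite enum_valP fE => /andP[x0 xs].
    by rewrite mulr_gt0 ?invr_gt0//= mulrC ltr_pdivrMr// mul1r.
  apply/rowP => i; have [iT|iT] := boolP (i \in T).
    by rewrite -(enum_rankK_in iT iT) gE fE mulVKf// gt_eqF.
  by rewrite g_out//; have := xT i; rewrite (negPf iT).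
- move=> y yT; split=> [i|].
    case: ifPn => iT; last exact: g_out.
    rewrite -(enum_rankK_in iT iT) gE.
    have /andP[y0 y1] := yT (enum_rank_in iT i).
    by rewrite mulr_gt0//= gtr_pMr.
  by apply/rowP => j; rewrite fE gE mulKf// gt_eqF.
- exact: smooth_on_affine.
- exact: smooth_on_affine.
(* The graph: the cell conditions on the first N variables, together with the
   linear equations y = f x. *)
pose v i : mpoly (N + #|T|) R := var (lshift #|T| i).
pose p (t : 'I_N + 'I_#|T|) : mpoly (N + #|T|) R :=
  match t with
  | inl i => cell_eq v i
  | inr j => var (rshift N j) - s^-1 *: v (enum_val j)
  end.
have := semialgebraic_system p (cell_ineq v).
have pj j (z : 'rV[R]_(N + #|T|)) :
    peval (p (inr j)) z = rsubmx z 0 j - f (lsubmx z) 0 j.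
  by rewrite /= /peval mevalB mevalZ -!/(peval _ _) !peval_var fE !mxE.
have vz (z : 'rV[R]_(N + #|T|)) i : peval (v i) z = lsubmx z 0 i.
  by rewrite peval_var mxE.
rewrite [X in semialgebraic X -> _](_ : _ = graph_on (coord_cell T s c) f)//.
apply/seteqP; split=> z /=.
  move=> [pz qz]; exists (lsubmx z).
    by apply/(cell_systemP (vz z)); split=> // i; exact: (pz (inl i)).
  rewrite -[RHS]hsubmxK; congr row_mx; apply/rowP => j.
  by have /eqP := pz (inr j); rewrite pj subr_eq0 => /eqP.
move=> [x xT <-].
have [|eqs ineqs] := (cell_systemP (vz (row_mx x (f x)))).1.
  by rewrite row_mxKl.
split=> // -[i|j]; first exact: eqs.
by rewrite pj row_mxKl row_mxKr subrr.
Qed.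

End Cell.

(** * Dimensions of cells and of slabs *)

(** Packages a decomposition indexed by any finite type whose maximal dimension
    is attained at a known index. *)
Lemma has_dim_bigcup_cells (R : realType) (N : nat) (J : finType)
    (C : J -> set 'rV[R]_N) (dims : J -> nat) (j0 : J) :
    trivIset [set: J] C ->
    (forall j, semialgebraic (C j)) ->
    (forall j, semialg_diffeomorphic (C j) (@open_cube R (dims j))) ->
    (forall j, (dims j <= dims j0)%N) ->
  has_dim (\bigcup_j C j) ((dims j0)%:R)%:E.
Proof.
move=> trivC saC diffC dims_le.
exists #|J|, (fun i => dims (enum_val i)), (fun i => C (enum_val i)); split=> //.
- apply/seteqP; split=> x [j _ xj]; last by exists (enum_val j).
  by exists (enum_rank j) => //; rewrite enum_rankK.
- move=> i i' _ _ /(trivC _ _ I I); exact: enum_val_inj.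
apply/le_anti/andP; split.
  rewrite -[in leLHS](enum_rankK j0).
  exact: (@le_bigmax _ (\bar R) _ -oo%E (fun i => ((dims (enum_val i))%:R)%:E)).
by apply: bigmax_le => [|i _]; [rewrite leNye | rewrite lee_fin ler_nat].
Qed.

Lemma has_dim_coord_cell (R : realType) (N : nat) (T : {set 'I_N}) (s : R)
    (c : 'rV[R]_N) : 0 < s -> has_dim (coord_cell T s c) (#|T|%:R)%:E.
Proof.
move=> s0.
have := @has_dim_bigcup_cells R N unit (fun=> coord_cell T s c) (fun=> #|T|) tt.
rewrite bigcup_const; last by exists tt.
apply=> //.
- by move=> [] [].
- by move=> _; exact: semialgebraic_coord_cell.
- by move=> _; exact: coord_cell_diffeo.
Qed.

Definition slab (R : realType) (r k : nat) (delta : R) : set 'rV[R]_(r + k) :=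
  [set x | (forall i, x 0 (lshift k i) = 0) /\
           (forall i, 0 <= x 0 (rshift r i) <= delta)].

(** The open faces are indexed by maps phi into option bool: in direction i,
    None stands for the open interval (0, delta), Some true for the end point
    delta and Some false for the end point 0.  Only the face with phi = None
    everywhere has dimension k. *)
Lemma has_dim_slab (R : realType) (r k : nat) (delta : R) : 0 < delta ->
  has_dim (@slab R r k delta) (k%:R)%:E.
Proof.
move=> delta0.
pose T (phi : {ffun 'I_k -> option bool}) : {set 'I_(r + k)} :=
  (@rshift r k @: [pred i | phi i == None]).
pose c (phi : {ffun 'I_k -> option bool}) : 'rV[R]_(r + k) :=
  row_mx 0 (\row_i (if phi i == Some true then delta else 0)).
have lT phi i : (lshift k i \in T phi) = false.
  by apply/negbTE/imsetP => -[j _ /eqP]; rewrite eq_lrshift.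
have rT phi i : (rshift r i \in T phi) = (phi i == None).
  by rewrite mem_imset ?inE//; exact: rshift_inj.
pose phi0 : {ffun 'I_k -> option bool} := [ffun=> None].
have cardT phi : #|T phi| = #|[pred i | phi i == None]|.
  by rewrite card_imset//; exact: rshift_inj.
have card0 : #|T phi0| = k.
  rewrite cardT -[RHS]card_ord; apply: eq_card => i.
  by rewrite !inE ffunE.
have cellP phi x : coord_cell (T phi) delta (c phi) x <->
    (forall i, x 0 (lshift k i) = 0) /\
    (forall i, match phi i with
               | None => is_true (0 < x 0 (rshift r i) < delta)
               | Some b => x 0 (rshift r i) = if b then delta else 0
               end).
  split=> [xT|[xl xr] i].
    split=> i; first by have := xT (lshift k i); rewrite lT row_mxEl mxE.
    by have := xT (rshift r i); rewrite rT row_mxEr mxE; case: (phi i) => [[]|].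
  case: (split_ordP i) => {}i ->.
    by rewrite lT xl row_mxEl mxE.
  by have := xr i; rewrite rT row_mxEr mxE; case: (phi i) => [[]|].
rewrite -[X in X%:R]card0.
have -> : @slab R r k delta = \bigcup_phi coord_cell (T phi) delta (c phi).
  apply/seteqP; split=> x.
    move=> [xl xr].
    exists [ffun i => if x 0 (rshift r i) == 0 then Some false else
                      if x 0 (rshift r i) == delta then Some true else None] => //.
    apply/cellP; split=> // i; rewrite ffunE.
    case: eqVneq => [->//|x0]; case: eqVneq => [->//|xd].
    by have /andP[x_ge0 x_led] := xr i; rewrite !lt_neqAle eq_sym x0 x_ge0 xd.
  move=> [phi _ /cellP[xl xr]]; split=> // i.
  case: (phi i) (xr i) => [[]->|/andP[/ltW-> /ltW->]]//.
    by rewrite lexx ltW.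
  by rewrite lexx ltW.
apply: (has_dim_bigcup_cells (dims := fun phi => #|T phi|)).
- move=> phi psi _ _ [x [/cellP[_ xphi] /cellP[_ xpsi]]]; apply/ffunP => i.
  move: (xphi i) (xpsi i).
  case: (phi i) => [[]|]; case: (psi i) => [[]|] //.
  + by move=> -> d0; rewrite d0 ltxx in delta0.
  + by move=> ->; rewrite ltxx andbF.
  + by move=> -> d0; rewrite -d0 ltxx in delta0.
  + by move=> ->; rewrite ltxx.
  + by move=> /andP[_ xd] xE; rewrite xE ltxx in xd.
  + by move=> /andP[x0 _] xE; rewrite xE ltxx in x0.
- by move=> phi; exact: semialgebraic_coord_cell.
- by move=> phi; exact: coord_cell_diffeo.
- by move=> phi; rewrite card0 cardT -[leqRHS]card_ord max_card.
Qed.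

(** * Monomials in the first variables *)

Definition first_monos (r k d : nat) : {set mono (r + k) d} :=
  [set m : mono (r + k) d | [forall i : 'I_k, m (rshift r i) == 0%N]]%SET.

(** Extending an exponent vector by zeros is a bijection from the monomials in r
    variables. *)
Lemma card_first_monos (r k d : nat) : #|first_monos r k d| = rho r d.
Proof.
pose ext (m : mono r d) : multinom (r + k) :=
  Multinom [tuple (if fintype.split i is inl j then (m : multinom r) j else 0%N)
           | i < r + k].
have extl m i : ext m (lshift k i) = (m : multinom r) i.
  by rewrite multinomE tnth_mktuple -/(unsplit (inl _)) unsplitK.
have extr m i : ext m (rshift r i) = 0%N.
  by rewrite multinomE tnth_mktuple -/(unsplit (inr _)) unsplitK.
have mdeg_ext m : (mdeg (ext m) < d.+1)%N.
  rewrite mdegE big_split_ord/= [X in (_ + X)%N]big1// addn0.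
  by under eq_bigr do rewrite extl; rewrite -mdegE; case: m.
have ext_inj : injective (fun m => BMultinom (mdeg_ext m)).
  move=> m1 m2 /(congr1 val)/= /mnmP eq_ext; apply/val_inj/mnmP => i.
  by have := eq_ext (lshift k i); rewrite !extl.
rewrite -card_mono -(card_imset _ ext_inj); apply: eq_card => m.
apply/idP/imsetP => [|[m' _ ->]].
  rewrite inE => /forallP mr.
  pose m0 := Multinom [tuple (m : multinom _) (lshift k i) | i < r].
  have m0P : (mdeg m0 < d.+1)%N.
    rewrite mdegE; under eq_bigr do rewrite multinomE tnth_mktuple.
    rewrite (leq_ltn_trans _ (valP m))//= mdegE big_split_ord/=.
    exact: leq_addr.
  exists (BMultinom m0P) => //; apply/val_inj/mnmP => i.
  case: (split_ordP i) => {}i -> /=; last by rewrite extr (eqP (mr i)).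
  by rewrite extl /= multinomE tnth_mktuple.
by rewrite inE; apply/forallP => i; rewrite /= extr.
Qed.

(** * Solutions for maps positive in the first coordinates *)

Lemma Sol_box_slab (R : realType) (r k : nat) (delta : R)
    (F : 'rV[R]_(r + k) -> 'rV[R]_(r + k)) : 0 < delta ->
    (forall x, box delta x -> forall i, 0 < F x 0 (lshift k i)) ->
    (forall x, box delta x -> forall i, F x 0 (rshift r i) = 0) ->
  Sol (box (n := r + k) delta) F = @slab R r k delta.
Proof.
move=> delta0 Fl Fr.
have innerE x y : box delta x -> inner (F x) (y - x) =
    \sum_(i < r) F x 0 (lshift k i) * (y 0 (lshift k i) - x 0 (lshift k i)).
  move=> xK; rewrite /inner big_split_ord/= [X in _ + X]big1 ?addr0.
    by apply: eq_bigr => i _; rewrite !mxE.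
  by move=> i _; rewrite Fr// mul0r.
apply/seteqP; split=> x.
  move=> [xK xsol]; split=> i; last exact: xK.
  (* Moving only coordinate i to 0 stays in the box and leaves the single term
     - F_i(x) * x_i in the inner product. *)
  pose y : 'rV[R]_(r + k) := \row_j (if j == lshift k i then 0 else x 0 j).
  have yK : box delta y.
    by move=> j; rewrite mxE; case: ifP => _; [rewrite lexx ltW | exact: xK].
  have := xsol _ yK; rewrite innerE// (bigD1 i)//= big1 => [|j ji].
    rewrite addr0 mxE eqxx sub0r mulrN oppr_ge0 pmulr_rle0; last exact: Fl.
    by have /andP[x0 _] := xK (lshift k i); move=> x_le0; apply/le_anti/andP.
  by rewrite mxE (inj_eq (@lshift_inj _ _)) (negPf ji) subrr mulr0.
move=> [xl xr].
have xK : box delta x.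
  by move=> i; case: (split_ordP i) => {}i -> //; rewrite xl lexx ltW.
split=> // y yK; rewrite innerE//; apply: sumr_ge0 => i _.
have /andP[y0 _] := yK (lshift k i).
by rewrite xl subr0 mulr_ge0// ltW// Fl.
Qed.

(** * The cell of matrices *)

Definition free_entries (r k d : nat) (mon : 'I_(rho (r + k) d) -> mono (r + k) d) :
    {set 'I_((r + k) * rho (r + k) d)} :=
  uncurry (@mxvec_index (r + k) (rho (r + k) d)) @:
    finset.setX (@lshift r k @: [set: 'I_r]%SET) (mon @^-1: first_monos r k d).

Section FreeEntries.
Variables (r k d : nat) (mon : 'I_(rho (r + k) d) -> mono (r + k) d).

Let index_inj : injective (uncurry (@mxvec_index (r + k) (rho (r + k) d))).
Proof.
have [g gK _] := curry_mxvec_bij (r + k) (rho (r + k) d).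
by apply: (can_inj (g := g)) => p; apply: gK; rewrite inE.
Qed.

Lemma in_free_entries_lshift i j :
  (mxvec_index (lshift k i) j \in free_entries mon) = (mon j \in first_monos r k d).
Proof.
rewrite -[mxvec_index _ _]/(uncurry _ (_, _)) mem_imset// inE/=.
by rewrite mem_imset ?inE//; exact: lshift_inj.
Qed.

Lemma in_free_entries_rshift i j : (mxvec_index (rshift r i) j \in free_entries mon) = false.
Proof.
rewrite -[mxvec_index _ _]/(uncurry _ (_, _)) mem_imset// inE/=.
apply/negbTE; rewrite negb_and; apply/orP; left.
by apply/imsetP => -[i' _ /eqP]; rewrite eq_rlshift.
Qed.

Lemma card_free_entries : bijective mon -> #|free_entries mon| = (r * rho r d)%N.
Proof.
move=> mon_bij; rewrite card_imset// cardsX; congr (_ * _)%N.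
  by rewrite card_imset ?cardsT ?card_ord//; exact: lshift_inj.
by rewrite on_card_preimset ?card_first_monos//; exact: onW_bij.
Qed.

End FreeEntries.

Lemma Dset_free_entries (R : realType) (r k d : nat)
    (mon : 'I_(rho (r + k) d) -> mono (r + k) d) (delta : R)
    (A : 'M[R]_(r + k, rho (r + k) d)) :
    bijective mon -> 0 < delta ->
    coord_cell (free_entries mon) 1 0 (mxvec A) ->
  Dset mon (box (n := r + k) delta) (k%:R)%:E A.
Proof.
move=> mon_bij delta0 AE.
have A_ge0 i j : 0 <= A i j.
  rewrite -mxvecE; have := AE (mxvec_index i j).
  by case: ifP => _; [case/andP => /ltW | move=> ->; rewrite mxE].
have A_rshift i j : A (rshift r i) j = 0.
  by rewrite -mxvecE; have := AE (mxvec_index (rshift r i) j);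
    rewrite in_free_entries_rshift mxE.
have [inv _ monK] := mon_bij.
(* The column of the constant monomial makes the first r components positive,
   the other columns contribute nonnegative terms. *)
pose j0 := inv (bm0 : mono (r + k) d).
have A_j0 i : 0 < A (lshift k i) j0.
  rewrite -mxvecE; have := AE (mxvec_index (lshift k i) j0).
  rewrite in_free_entries_lshift ifT; first by case/andP.
  by rewrite inE monK; apply/forallP => i'; rewrite mnm0E.
rewrite /Dset/= Sol_box_slab//; first exact: has_dim_slab.
  move=> x xK i; rewrite !mxE (bigD1 j0)//= ltr_pwDl//.
    rewrite mulr_gt0// mxE big1// => i' _.
    by rewrite monK mnm0E expr0.
  apply: sumr_ge0 => j _; rewrite mulr_ge0// mxE prodr_ge0// => i' _.
  by rewrite exprn_ge0//; have /andP[] := xK i'.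
by move=> x _ i; rewrite !mxE big1// => j _; rewrite A_rshift mul0r.
Qed.

Theorem theorem6p3 (R : realType) (n d : nat)
    (mon : 'I_(rho n d) -> mono n d) (delta : R)
    (hmon : bijective mon) (hd : (0 < d)%N) (hdelta : 0 < delta) :
  forall k : nat, (k <= n)%N ->
    Dset mon (box (n := n) delta) (k%:R)%:E !=set0 /\
    exists E : set 'M[R]_(n, rho n d),
      [/\ E `<=` Dset mon (box (n := n) delta) (k%:R)%:E,
          mx_semialgebraic E &
          mx_has_dim E (((n - k) * rho (n - k) d)%N%:R)%:E].
Proof.
move=> k le_kn; set r := (n - k)%N.
have n_rk : n = (r + k)%N by rewrite subnK.
clearbody r; subst n.
pose cell := coord_cell (R := R) (free_entries mon) 1 0.
pose E : set 'M[R]_(r + k, rho (r + k) d) := [set A | cell (mxvec A)].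
have ED : E `<=` Dset mon (box (n := r + k) delta) (k%:R)%:E.
  by move=> A AE; exact: Dset_free_entries.
have imE : [set mxvec A | A in E] = cell.
  apply/seteqP; split=> [_ [A AE <-]//|v vcell].
  by exists (vec_mx v); rewrite /E/= ?vec_mxK.
split; last first.
  exists E; split=> //; first by rewrite /mx_semialgebraic imE;
    exact: semialgebraic_coord_cell.
  by rewrite /mx_has_dim imE -(card_free_entries hmon); exact: has_dim_coord_cell.
exists (vec_mx (\row_l (if l \in free_entries mon then 2^-1 else 0))); apply: ED.
rewrite /E/= vec_mxK => l; rewrite !mxE; case: ifP => lT; rewrite lT//.
by rewrite invr_gt0 ltr0n invf_lt1 ?ltr1n// ltr0n.
Qed.
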